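(* Let $(l_1,\mathcal{I}_1)$ and $(l_2,\mathcal{I}_2)$ be two Erlangen lines. Given two different points $A_0,A_1$ of $l_1$ and two different points $B_0,B_1$ of $l_2$, there is a unique bijection $f:l_1\to l_2$ preserving betweenness such that $f(A_0)=B_0$, $f(A_1)=B_1$, and such that $|AB|=|CD|$ in $l_1$ implies $|f(A)f(B)|=|f(C)f(D)|$ in $l_2$ for all $A,B,C,D\in l_1$. In particular, the Erlangen lines $l_1$ and $l_2$ are isomorphic.
   Context: A betweenness relation on a set $\Pi$ is a ternary relation ''$C$ is between $A$ and $B$'' such that, writing $s[A,B]$ for the set of all points between $A$ and $B$: (a) each point is between itself and any point of $\Pi$; (b) if $A$ is between $B$ and $C$, then $A$ is between $C$ and $B$; (c) if $C\in s[A,B]$, then $s[A,B]=s[A,C]\cup s[C,B]$ and $s[A,C]\cap s[C,B]=s[C,C]=\{C\}$. A closed line segment is a set of the form $s[A,B]$. A subset $S$ is convex if $s[A,B]\subset S$ for all $A,B\in S$. A closed line segment is connected if, whenever it is expressed as a union of two disjoint non-empty convex subsets, precisely one of them is a closed line segment. A function $f$ preserves betweenness if $f(C)$ is between $f(A)$ and $f(B)$ whenever $C$ is between $A$ and $B$. An isomorphism of sets with betweenness is a bijection with $f(s[A,B])=s[f(A),f(B)]$ for all $A,B$. A connected line is a set $l$ with betweenness, consisting of at least two points, all of whose closed line segments are connected, such that for every $A\in l$ the complement $l\setminus\{A\}$ is the union of two disjoint non-empty convex sets $c_1,c_2$ with $A\in s[B,C]$ whenever $B\in c_1$, $C\in c_2$;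 the maximal rays of $l$ emanating from $A$ are the two sets $\{A\}\cup c_1$, $\{A\}\cup c_2$. An Erlangen line is a pair $(l,\mathcal{I})$ where $l$ is a connected line and $\mathcal{I}$ is a subgroup of the group of isomorphisms of $l$ such that for every ordered pair of maximal rays in $l$ there is exactly one element of $\mathcal{I}$ sending the first ray onto the second. In an Erlangen line, $|AB|=|CD|$ means that $s[A,B]$ and $s[C,D]$ are congruent, i.e. there is $\tau\in\mathcal{I}$ with $\tau(s[A,B])=s[C,D]$. An isomorphism of Erlangen lines from $(l_1,\mathcal{I}_1)$ to $(l_2,\mathcal{I}_2)$ is a bijection $f:l_1\to l_2$ preserving betweenness such that a bijection $g:l_2\to l_2$ belongs to $\mathcal{I}_2$ if and only if $f^{-1}\circ g\circ f$ belongs to $\mathcal{I}_1$. *)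

(* Defs.v *)
From mathcomp Require Import all_boot.
From mathcomp Require Import boolp classical_sets.

Set Implicit Arguments.
Unset Strict Implicit.
Unset Printing Implicit Defensive.

Local Open Scope classical_set_scope.

(* [between C A B] reads "C is between A and B". *)
Definition segment (T : Type) (between : T -> T -> T -> Prop) (A B : T) :
  set T := [set C | between C A B].

Record betweenSet := BetweenSet {
  point :> Type;
  between : point -> point -> point -> Prop;
  between_refl : forall A B : point, between A A B;
  between_sym : forall A B C : point, between A B C -> between A C B;
  between_split : forall A B C : point, segment between A B C ->
    [/\ segment between A B = segment between A C `|` segment between C B,
        segment between A C `&` segment between C B = segment between C C
      & segment between C C = [set C]] }.

Definition seg (T : betweenSet) (A B : T) : set T := segment (@between T) A B.

Definition closed_segment (T : betweenSet) (S : set T) : Prop :=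
  exists A B : T, S = seg A B.

Definition convex (T : betweenSet) (S : set T) : Prop :=
  forall A B : T, S A -> S B -> seg A B `<=` S.

Definition connected_segment (T : betweenSet) (S : set T) : Prop :=
  forall U V : set T, convex U -> convex V -> U !=set0 -> V !=set0 ->
    U `&` V = set0 -> S = U `|` V ->
    (closed_segment U /\ ~ closed_segment V) \/
    (~ closed_segment U /\ closed_segment V).

Definition preserves_betweenness (T T' : betweenSet) (f : T -> T') : Prop :=
  forall A B C : T, between C A B -> between (f C) (f A) (f B).

Definition isomorphism (T T' : betweenSet) (f : T -> T') : Prop :=
  bijective f /\ forall A B : T, f @` seg A B = seg (f A) (f B).

Definition separates (T : betweenSet) (A : T) (c1 c2 : set T) : Prop :=
  [/\ ~` [set A] = c1 `|` c2 /\ c1 `&` c2 = set0,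
      c1 !=set0 /\ c2 !=set0,
      convex c1 /\ convex c2
    & forall B C : T, c1 B -> c2 C -> seg B C A].

Definition connected_line (T : betweenSet) : Prop :=
  [/\ exists A B : T, A <> B,
      forall S : set T, closed_segment S -> connected_segment S
    & forall A : T, exists c1 c2 : set T, separates A c1 c2].

(* Since [separates A] is symmetric in its two sets, this covers both maximal
   rays emanating from [A]. *)
Definition maximal_ray_from (T : betweenSet) (A : T) (r : set T) : Prop :=
  exists c1 c2 : set T, separates A c1 c2 /\ r = [set A] `|` c1.

Definition maximal_ray (T : betweenSet) (r : set T) : Prop :=
  exists A : T, maximal_ray_from A r.

Definition isomorphism_subgroup (T : betweenSet) (I : set (T -> T)) : Prop :=
  [/\ forall f, I f -> isomorphism f,
      I id,
      forall f g, I f -> I g -> I (f \o g)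
    & forall f g, I f -> cancel f g -> cancel g f -> I g].

Record erlangenLine := ErlangenLine {
  line :> betweenSet;
  motion : set (line -> line);
  line_connected : connected_line line;
  motion_subgroup : isomorphism_subgroup motion;
  motion_rays : forall r1 r2 : set line, maximal_ray r1 -> maximal_ray r2 ->
    exists! tau : line -> line, motion tau /\ tau @` r1 = r2 }.

(* |AB| = |CD| *)
Definition eq_dist (L : erlangenLine) (A B C D : L) : Prop :=
  exists2 tau : L -> L, motion tau & tau @` seg A B = seg C D.

Definition erlangen_isomorphism (L1 L2 : erlangenLine) (f : L1 -> L2) : Prop :=
  preserves_betweenness f /\
  exists finv : L2 -> L1, [/\ cancel f finv, cancel finv f
    & forall g : L2 -> L2, bijective g ->
        (motion g <-> motion (finv \o g \o f))].

Definition erlangen_isomorphic (L1 L2 : erlangenLine) : Prop :=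
  exists f : L1 -> L2, erlangen_isomorphism f.

(* Main.v *)
From Pilot Require Import Defs.
From HB Require Import structures.
From mathcomp Require Import all_boot all_order all_algebra.
From mathcomp Require Import boolp classical_sets reals Rstruct.
From mathcomp Require Import zify ring lra.

(* A connected line carries a linear order inducing its betweenness, and this
   order is dense and complete.  Motions are increasing or decreasing, and
   exactly one increasing motion t_P sends a chosen origin O to P, so that
   P + Q := t_P(Q) makes the line a group.  If s is the decreasing motion
   fixing O, the decreasing motion t_P s has a fixed point by completeness,
   hence is an involution; this says that s is the inversion of the group.
   Being also an automorphism, it makes the group commutative, and the fixed
   points of the t_P s are halves.  By Hoelder's argument the line is then the
   additive group of the reals, its motions being x |-> p + x and x |-> p - x.
   Any f as in the theorem becomes, in these coordinates, a monotone map that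
   preserves equality of distances and fixes 0 and 1, that is, the identity. *)

Set Implicit Arguments.
Unset Strict Implicit.
Unset Printing Implicit Defensive.

Import Order.TTheory GRing.Theory Num.Theory.

Local Open Scope classical_set_scope.
Local Open Scope ring_scope.

Definition lub_property (T : Type) (le : rel T) : Prop :=
  forall S : set T, S !=set0 -> (exists b, forall x, S x -> le x b) ->
    exists2 s, forall x, S x -> le x s &
      forall b, (forall x, S x -> le x b) -> le s b.

(** * The order of a connected line *)

Section Betweenness.

Variable T : betweenSet.
Implicit Types A B C D X Y Z : T.

Lemma seg_l A B : seg A B A. Proof. exact: between_refl. Qed.

Lemma seg_sym A B C : seg A B C -> seg B A C.
Proof. exact: between_sym. Qed.

Lemma seg_r A B : seg A B B. Proof. exact/seg_sym/seg_l. Qed.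

Lemma segAA A B : seg A A B -> B = A.
Proof. by have [_ _ h] := between_split (seg_l A A); rewrite /seg h. Qed.

Lemma seg_split A B C D : seg A B C -> seg A B D -> seg A C D \/ seg C B D.
Proof. by move=> /between_split[h _ _]; rewrite {1}/seg h. Qed.

Lemma seg_sub A B C D : seg A B C -> seg A C D -> seg A B D.
Proof. by move=> /between_split[h _ _]; rewrite {2}/seg h; left. Qed.

Lemma seg_inter A B C D : seg A B C -> seg A C D -> seg C B D -> D = C.
Proof.
move=> /between_split[_ h1 h2] ? ?; have : [set C] D by rewrite -h2 -h1.
by [].
Qed.

Lemma seg_anti A B C : seg A B C -> seg A C B -> B = C.
Proof. by move=> ? ?; apply: (@seg_inter A B C) => //; exact: seg_r. Qed.

(** [D] splits [seg A B], so [C] lies in [seg A D] or in [seg D B]; in the first case [seg_anti]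
    gives [C = D]. *)
Lemma seg_subr A B C D : seg A B C -> seg A C D -> seg D B C.
Proof.
move=> hC hD; have [h|//] := seg_split (seg_sub hC hD) hC.
by rewrite (seg_anti hD h); exact: seg_l.
Qed.

(** Splitting at [Y] puts [X] into [seg A Y] or [seg Y B]; two uses of [seg_sub] then bring
    [seg X Y] into [seg A B]. *)
Lemma seg_convex A B : convex (seg A B).
Proof.
move=> X Y hX hY Z hZ; have [h|h] := seg_split hY hX.
  apply: seg_sub hY _; apply: seg_sym.
  exact: seg_sub (seg_sym h) (seg_sym hZ).
apply: seg_sym; apply: seg_sub (seg_sym hY) _; apply: seg_sym.
by apply: seg_sub h _; exact: seg_sym.
Qed.

Lemma convexI (U V : set T) : convex U -> convex V -> convex (U `&` V).
Proof.
move=> hU hV A B [UA VA] [UB VB] C hC.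
by split; [exact: hU hC|exact: hV hC].
Qed.

Lemma convex1 A : convex [set A].
Proof. by move=> X Y -> -> Z /segAA. Qed.

(** * Sides of a point and linearity of betweenness *)

Hypothesis T_line : connected_line T.

(** A Boolean label for the two sides of [Y]. Neither side contains [Y], so by convexity [Y] never
    lies between two points of the same side. *)
Lemma line_sides Y : exists s : T -> bool,
  forall X Z, X <> Y -> Z <> Y -> (seg X Z Y <-> s X != s Z).
Proof.
have [_ _ /(_ Y)[c1 [c2 [[cover dis] _ [cvx1 cvx2] opp]]]] := T_line.
have c2E X : X <> Y -> c2 X <-> ~ c1 X.
  move=> XY; split=> [x2 x1|x1].
    by have : set0 X by rewrite -dis.
  by have : (~` [set Y]) X by []; rewrite cover => -[].
have Yc1 : ~ c1 Y.
  by move=> y1; have : (c1 `|` c2) Y by [left]; rewrite -cover => /(_ erefl).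
have Yc2 : ~ c2 Y.
  by move=> y2; have : (c1 `|` c2) Y by [right]; rewrite -cover => /(_ erefl).
exists (fun X => `[< c1 X >]) => X Z XY ZY.
have [x1|/(c2E _ XY) x2] := pselect (c1 X);
  have [z1|/(c2E _ ZY) z2] := pselect (c1 Z).
- by rewrite !asboolT //; split => // h; case: Yc1; exact: cvx1 h.
- rewrite asboolT// asboolF; last exact/c2E.
  by split => // _; exact: opp.
- rewrite [in X in _ <-> X]asboolF ?asboolT //; last exact/c2E.
  by split => // _; apply: seg_sym; exact: opp.
- rewrite !asboolF; [|exact/c2E..].
  by split => // h; case: Yc2; exact: cvx2 h.
Qed.

(** Apart from degenerate cases, [A] is on the side of [Y] opposite to [B] or on the side opposite
    to [C]. *)
Lemma seg_other A B C Y : seg B C Y -> seg A B Y \/ seg A C Y.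
Proof.
have [->|AY] := pselect (A = Y); first by left; exact: seg_l.
have [->|BY] := pselect (B = Y); first by left; exact: seg_r.
have [->|CY] := pselect (C = Y); first by right; exact: seg_r.
have [s sP] := line_sides Y.
move=> /sP -/(_ BY CY) h; case: (boolP (s A == s B)) => [/eqP AB|AB].
  by right; apply/sP => //; rewrite AB.
by left; apply/sP.
Qed.

(** Pigeonhole: of three points other than [Y], two lie on the same side of [Y]. *)
Lemma seg_all3 A B C Y : seg B C Y -> seg A B Y -> seg A C Y ->
  [\/ A = Y, B = Y | C = Y].
Proof.
have [->|AY] := pselect (A = Y); first by constructor 1.
have [->|BY] := pselect (B = Y); first by constructor 2.
have [->|CY] := pselect (C = Y); first by constructor 3.
have [s sP] := line_sides Y.
move=> /sP -/(_ BY CY) h /sP -/(_ AY BY) h' /sP -/(_ AY CY) h''.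
by move: h h' h''; case: (s A) (s B) (s C) => [] [] [].
Qed.

(* Otherwise the segments joining the three points would be the pairwise
   unions of three disjoint convex sets, the arms; of any two arms exactly one
   is a closed segment, which is impossible for three arms. *)
Lemma seg_total A B C : [\/ seg A B C, seg A C B | seg B C A].
Proof.
apply: contrapT => h.
have {h} [nC nB nA] : [/\ ~ seg A B C, ~ seg A C B & ~ seg B C A].
  by split => ?; apply: h; [constructor 1|constructor 2|constructor 3].
have arms X Y Z : ~ seg X Y Z -> ~ seg X Z Y -> ~ seg Y Z X ->
  let U := seg X Y `&` seg X Z in let V := seg X Y `&` seg Y Z in
  (closed_segment U /\ ~ closed_segment V) \/
  (~ closed_segment U /\ closed_segment V).
  move=> nZ nY nX U V; have [_ conn _] := T_line.
  apply: (conn (seg X Y)); first by exists X, Y.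
  - by apply: convexI; exact: seg_convex.
  - by apply: convexI; exact: seg_convex.
  - by exists X; split; exact: seg_l.
  - by exists Y; split; [exact: seg_r|exact: seg_l].
  - apply/seteqP; split => // W [[xy xz] [_ yz]].
    by case: (seg_all3 yz xy xz) => WE; rewrite -WE in xy xz yz.
  - apply/seteqP; split => W; last by case=> -[].
    move=> xy; case: (seg_other Z xy) => zw; [left|right]; split => //.
      exact: seg_sym.
    exact: seg_sym.
have := arms A B C nC nB nA.
have := arms A C B nB nC (fun h => nA (seg_sym h)).
have := arms B C A nA (fun h => nC (seg_sym h)) (fun h => nB (seg_sym h)).
have symE X Y : seg X Y = seg Y X by apply/seteqP; split => ?; exact: seg_sym.
rewrite /= (symE B A) (symE C B) (symE C A) [seg A C `&` seg A B]setIC.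
rewrite [seg B C `&` seg A B]setIC [seg B C `&` seg A C]setIC.
tauto.
Qed.


Lemma line_extend Y : exists X Z, [/\ X <> Y, Z <> Y & seg X Z Y].
Proof.
have [_ _ /(_ Y)[c1 [c2 [[cover _] [[X x1] [Z z2]] _ opp]]]] := T_line.
exists X, Z; split; last exact: opp.
  have : (c1 `|` c2) X by left.
  by rewrite -cover.
have : (c1 `|` c2) Z by right.
by rewrite -cover.
Qed.

(** Connectedness of segments yields density and completeness; end points are absent because both
    sides of every point are non-empty. *)
Lemma line_order O E : O <> E -> exists le : rel T,
  [/\ reflexive le, antisymmetric le, transitive le & total le] /\
  [/\ le O E,
      forall A B C, seg A B C <-> le A C && le C B || le B C && le C A,
      forall X, (exists2 Y, Y <> X & le Y X) /\ (exists2 Z, Z <> X & le X Z),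
      forall X Y, X <> Y -> le X Y ->
        exists Z, [/\ Z <> X, Z <> Y, le X Z & le Z Y]
    & lub_property le].
Proof.
move=> OE; have [s sP] := line_sides O.
have EO : E <> O by move/esym.
(* The order is read off from far away on the side of [O] not containing [E]:
   [X <= Y] when [X] lies between [Y] and all points that are far enough. *)
pose N X := X <> O /\ s X != s E.
have [w0 Nw0] : exists w, N w.
  have [X [Z [XO ZO /sP -/(_ XO ZO) XZ]]] := line_extend O.
  have [XE|XE] := boolP (s X == s E); last by exists X.
  by exists Z; split; rewrite // -(eqP XE) eq_sym.
(* From here on, [seg O z w] is read as: [z] is at or beyond [w], seen from [O]. *)
have Nbeyond w z : N w -> seg O z w -> N z.
  move=> [wO sw] zw; have zO : z <> O.
    by move=> zO; apply: wO; apply: segAA; rewrite -{2}zO.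
  split=> //; apply/negP => /eqP sz; apply: (wO).
  apply: (@seg_anti z); last exact: seg_sym.
  by apply/sP => //; rewrite sz eq_sym.
have Ntotal w w' : N w -> N w' -> seg O w w' \/ seg O w' w.
  move=> [wO sw] [wO' sw'].
  have [||/sP -/(_ wO wO')] := seg_total O w w'; [by left|by right|].
  by move: sw sw'; case: (s w) (s w') (s E) => [] [] [].
(* [far P] means that [P] holds from some point of [N] outwards. This is a proper filter, since two
   points of [N] are always comparable as seen from [O]. *)
pose far P := exists2 w, N w & forall z, seg O z w -> P z.
have far_and P Q : far P -> far Q -> far (fun z => P z /\ Q z).
  move=> [w Nw Pw] [w' Nw' Qw']; have [h|h] := Ntotal _ _ Nw Nw'.
    exists w => // z zw; split; first exact: Pw.
    by apply: Qw'; exact: seg_sub h.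
  exists w' => // z zw; split; last exact: Qw'.
  by apply: Pw; exact: seg_sub h.
have far_ex P : far P -> exists2 z, N z & P z.
  by move=> [w Nw Pw]; exists w => //; apply: Pw; exact: seg_r.
have far_imp (P Q : T -> Prop) : (forall z, P z -> Q z) -> far P -> far Q.
  by move=> PQ [w Nw Pw]; exists w => // z /Pw/PQ.
(* Far enough out, [w] lies between [X] and every point beyond [w]. One may start at [X] if it is in
   [N], and otherwise at [w0], since [O] then lies between [X] and all points beyond [w0]. *)
have far_left X : far (fun w => forall z, seg O z w -> seg z X w).
  have [w Nw hw] : far (fun z => exists2 w, seg O z w &
      forall z', seg O z' w -> seg z' X w).
    have [[XO sX]|NX] := pselect (N X).
      exists X => // z zX; exists X => // z' _; exact: seg_r.
    exists w0 => // z zw; exists w0 => // z' zw'.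
    have [z'O sz'] := Nbeyond _ _ Nw0 zw'.
    have OX : seg z' X O.
      have [->|XO] := pselect (X = O); first exact: seg_r.
      apply/sP => //; apply/negP => /eqP sE; apply: NX; split => //.
      by rewrite -sE.
    by apply: seg_sub OX _; exact: seg_sym.
  exists w => // w' /hw[w'' ww'' hw''] z zw'.
  apply: (@seg_sub _ _ w''); first exact/hw''/(seg_sub zw').
  by apply: seg_sym; exact: seg_subr ww''.
pose leP X Y := far (fun z => seg z Y X).
have leP_total X Y : leP X Y \/ leP Y X.
  have [w Nw [hX hY]] := far_ex _ (far_and _ _ (far_left X) (far_left Y)).
  have dir A B : (forall z, seg O z w -> seg z A w) -> seg w A B -> leP B A.
    move=> hA wAB; exists w => // z zw; apply: seg_sym.
    by apply: seg_sub (seg_sym wAB); apply/seg_sym/hA.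
  have [||] := seg_total w X Y; [by right; exact: dir|by left; exact: dir|].
  (* If [w] lies between [X] and [Y], it is on all three segments joining [X], [Y] and a point [z]
     strictly beyond [w], hence equals [X] or [Y]. *)
  move=> XYw; have [z zO zw] : exists2 z, seg O z w & z <> w.
    have [P [Q [Pw Qw]]] := line_extend w.
    by move=> /(seg_other O)[|] ?; [exists P|exists Q].
  have [//|Xw|Yw] := seg_all3 XYw (hX _ zO) (hY _ zO).
    by left; apply: dir => //; rewrite Xw; exact: seg_l.
  by right; apply: dir => //; rewrite Yw; exact: seg_l.
have leP_anti X Y : leP X Y -> leP Y X -> X = Y.
  by move=> XY YX; have [z _ [/seg_anti]] := far_ex _ (far_and _ _ YX XY); apply.
have leP_trans X Y Z : leP X Y -> leP Y Z -> leP X Z.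
  move=> XY YZ; apply: far_imp (far_and _ _ XY YZ) => z [h1 h2].
  exact: seg_sub h2 h1.
have seg_mono A B C : leP A B -> seg A B C -> leP A C /\ leP C B.
  move=> AB ABC; split; apply: far_imp AB => z h; apply: seg_sym.
    exact: seg_subr (seg_sym h) (seg_sym ABC).
  exact: seg_sub (seg_sym h) (seg_sym ABC).
have seg_leP A B C :
    seg A B C <-> leP A C /\ leP C B \/ leP B C /\ leP C A.
  split.
    move=> ABC; have [AB|BA] := leP_total A B; [left|right]; apply: seg_mono => //.
    exact: seg_sym.
  wlog suff: A B / leP A C /\ leP C B -> seg A B C.
    by move=> H [/H//|/H/seg_sym].
  move=> [AC CB]; have [z _ [h1 h2]] := far_ex _ (far_and _ _ AC CB).
  exact: seg_subr h2 h1.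
have leP_connected A B : connected_segment (seg A B).
  by have [_ h _] := T_line; apply: h; exists A, B.
exists (fun X Y => `[< leP X Y >]); split; split.
- by move=> X; apply/asboolP; exists w0 => // z _; exact: seg_r.
- by move=> X Y /andP[/asboolP XY /asboolP YX]; exact: leP_anti.
- by move=> Y X Z /asboolP XY /asboolP YZ; apply/asboolP; exact: leP_trans YZ.
- by move=> X Y; apply/orP; case: (leP_total X Y) => ?; [left|right]; apply/asboolP.
- apply/asboolP; exists w0 => // z /(Nbeyond _ _ Nw0)[zO sz].
  by apply/sP.
- move=> A B C; rewrite seg_leP; split.
    by move=> [[? ?]|[? ?]]; apply/orP; [left|right]; apply/andP; split; apply/asboolP.
  by move=> /orP[|] /andP[/asboolP ? /asboolP ?]; [left|right].
- move=> X; have [P [Q [PX QX]]] := line_extend X.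
  by move=> /seg_leP[|] [h1 h2]; split; [exists P|exists Q|exists Q|exists P];
    rewrite //; apply/asboolP.
(* Density: a segment without inner points would be the disjoint union of two singletons, both of
   them closed segments. *)
- move=> X Y XY /asboolP leXY; apply: contrapT => /forallNP nZ.
  have segE : seg X Y = [set X] `|` [set Y].
    apply/seteqP; split => Z; last by move=> [->|->]; [exact: seg_l|exact: seg_r].
    move=> /(seg_mono _ _ _ leXY)[XZ ZY]; apply: contrapT => h.
    by apply: (nZ Z); split; [move=> ?; apply: h; left|
      move=> ?; apply: h; right|apply/asboolP..].
  have closed1 (P : T) : closed_segment [set P].
    exists P, P; apply/seteqP; split => Q.
      by move=> ->; exact: seg_l.
    by move=> /segAA.
  have [|||||//||] := @leP_connected X Y [set X] [set Y].
  + exact: convex1.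
  + exact: convex1.
  + by exists X.
  + by exists Y.
  + by apply/seteqP; split => // P [-> /XY].
  + by move=> [_ /(_ (closed1 Y))].
  + by move=> [/(_ (closed1 X))].
(* Completeness: unless [a] bounds [S], the segment from [a] to [b] is cut into the upper bounds [V]
   of [S] and the rest [U]; exactly one of these is a closed segment. *)
- move=> S [a Sa] [b /(_ _ _)/asboolP Sb].
  pose ub x := forall y, S y -> leP y x.
  suff [m mub mlub] : exists2 m, ub m & forall y, ub y -> leP m y.
    exists m => [y Sy|y Sy]; apply/asboolP; first exact: mub.
    by apply: mlub => z /Sy/asboolP.
  have ubb : ub b by move=> y Sy; apply: Sb.
  have [uba|nuba] := pselect (ub a); first by exists a => // y; apply.
  have leab : leP a b := ubb _ Sa.
  have in_seg x : seg a b x <-> leP a x /\ leP x b.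
    rewrite seg_leP; split; last by left.
    move=> [//|[bx xa]].
    by split; [exact: leP_trans leab bx|exact: leP_trans xa leab].
  pose V := seg a b `&` ub; pose U := seg a b `&` (fun x => ~ ub x).
  have min2 P Q : exists m, seg P Q m /\ forall y, seg P Q y -> leP m y.
    by have [PQ|QP] := leP_total P Q; [exists P|exists Q];
      (split; [exact: seg_l || exact: seg_r|]) => y;
      [move=> /(seg_mono _ _ _ PQ)[]|move=> /seg_sym/(seg_mono _ _ _ QP)[]].
  have max2 P Q : exists m, seg P Q m /\ forall y, seg P Q y -> leP y m.
    by have [PQ|QP] := leP_total P Q; [exists Q|exists P];
      (split; [exact: seg_l || exact: seg_r|]) => y;
      [move=> /(seg_mono _ _ _ PQ)[]|move=> /seg_sym/(seg_mono _ _ _ QP)[]].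
  have ub_up x y : leP x y -> ub x -> ub y.
    by move=> xy hx z /hx zx; exact: leP_trans zx xy.
  have [|||||||] := @leP_connected a b U V.
  + apply: convexI; first exact: seg_convex.
    move=> P Q uP uQ R PQR uR.
    by have /seg_leP[[_ h]|[_ h]] := PQR; [apply: uQ|apply: uP]; exact: ub_up h uR.
  + apply: convexI; first exact: seg_convex.
    move=> P Q uP uQ R PQR.
    by have /seg_leP[[h _]|[h _]] := PQR; [apply: ub_up h uP|apply: ub_up h uQ].
  + by exists a; split => //; exact: seg_l.
  + by exists b; split => //; exact: seg_r.
  + by apply/seteqP; split => // P [[_ h] [_ /h]].
  + apply/seteqP; split => P; last by case=> -[].
    by move=> abP; have [?|?] := pselect (ub P); [right|left].
  (* If [U] has a largest point [m], some [c] in [S] is not below [m]; being outside [U], it is an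
     upper bound and so the maximum of [S]. *)
  + move=> [[P [Q UE]] _]; have [m [mU mmax]] := max2 P Q.
    rewrite -UE in mU mmax; have [abm num] := mU.
    have [c /not_implyP[Sc cm]] : exists c, ~ (S c -> leP c m).
      by apply/existsNP.
    have abc : seg a b c.
      apply/in_seg; split; last exact: ubb.
      have [ac//|ca] := leP_total a c; exfalso; apply: cm.
      by have /in_seg[am _] := abm; exact: leP_trans ca am.
    have ubc : ub c.
      by apply: contrapT => nubc; apply: cm; apply: mmax; split.
    by exists c => // y; apply.
  (* If [V] is the closed one, its least point is the supremum. *)
  + move=> [_ [P [Q VE]]]; have [m [mV mmin]] := min2 P Q.
    rewrite -VE in mV mmin; have [abm um] := mV.
    exists m => // y uy; have [yb|by_] := leP_total y b.
      by apply: mmin; split => //; apply/in_seg; split => //; exact: uy.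
    by have /in_seg[_ mb] := abm; exact: leP_trans by_.
Qed.

End Betweenness.

(** * Complete ordered groups *)

Section Hoelder.

Variables (R : realType) (V : zmodType) (le : rel V) (u : V).
Hypothesis le_refl : reflexive le.
Hypothesis le_anti : antisymmetric le.
Hypothesis le_trans : transitive le.
Hypothesis le_total : total le.
Hypothesis leD2l : forall z x y, le x y -> le (z + x) (z + y).
Hypothesis le_lub : lub_property le.
Hypothesis halves : forall x : V, exists y, y + y = x.
Hypothesis u_ge0 : le 0 u.
Hypothesis u_neq0 : u != 0.

Let leD x y z t : le x y -> le z t -> le (x + z) (y + t).
Proof.
move=> xy zt; apply: (@le_trans (x + t)); first exact: leD2l.
by rewrite ![_ + t]addrC; exact: leD2l.
Qed.

Let le_subr x y : le 0 (y - x) = le x y.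
Proof.
apply/idP/idP => /leD2l h; first by have := h x; rewrite addr0 addrC subrK.
by have := h (- x); rewrite addNr addrC.
Qed.

Let leMn n x y : le x y -> le (x *+ n) (y *+ n).
Proof.
by move=> xy; elim: n => [|n IHn]; rewrite ?mulr0n// !mulrS; exact: leD.
Qed.

Let leMz (m n : int) : le (u *~ m) (u *~ n) <-> m <= n.
Proof.
have mono (p q : int) : p <= q -> le (u *~ p) (u *~ q).
  rewrite -subr_ge0 -le_subr -mulrzBr; case: (q - p) => // k _.
  by have := leMn k u_ge0; rewrite mul0rn -pmulrn.
split=> [h|]; last exact: mono.
rewrite leNgt; apply/negP => nm; have /mono h1 : n + 1 <= m by lia.
have := le_trans h1 h; rewrite mulrzDr mulr1z => h2.
have /negP := u_neq0; apply; apply/eqP/le_anti; rewrite u_ge0 andbT.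
by have := leD2l (- (u *~ n)) h2; rewrite addKr addNr.
Qed.

(** If the multiples of [d] were bounded, with supremum [s], then [s - d] would bound them too,
    forcing [d] to be at most 0. *)
Let archimedean d x : le 0 d -> d != 0 -> exists n, le x (d *+ n).
Proof.
move=> d0 dn0; apply: contrapT => /forallNP nx.
have [||s sub slub] := @le_lub [set y | exists n, y = d *+ n].
- by exists 0, 0%N.
- exists x => _ [n ->]; have /orP[//|h] := le_total (d *+ n) x.
  by case: (nx n).
have : le s (s - d).
  apply: slub => _ [n ->]; have /(leD2l (- d)) := sub _ (ex_intro _ n.+1 erefl).
  by rewrite mulrS addKr addrC.
rewrite -le_subr addrAC subrr add0r => /(leD2l d); rewrite addr0 subrr => h.
have /negP := dn0; apply; apply/eqP/le_anti; rewrite d0 andbT.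
exact: h.
Qed.

(** The lower rational approximations [m / n] to the ratio of [x] to the unit [u]; their supremum
    [phi x] is the coordinate of [x]. *)
Let slopes x : set R :=
  [set r | exists m : int, exists n : nat,
     [/\ (0 < n)%N, r = m%:~R / n%:R & le (u *~ m) (x *+ n)]].

(** Clearing denominators compares two multiples of [u] through [x *+ (n * n')]. *)
Let slope_le x (m m' : int) (n n' : nat) : (0 < n)%N -> (0 < n')%N ->
  le (u *~ m) (x *+ n) -> le (x *+ n') (u *~ m') ->
  m%:~R / n%:R <= m'%:~R / n'%:R :> R.
Proof.
move=> n0 n'0 /(leMn n') h /(leMn n) h'.
rewrite ler_pdivrMr ?ltr0n// mulrAC ler_pdivlMr ?ltr0n//.
rewrite !pmulrn -!intrM ler_int; apply/leMz; rewrite !mulrzA -!pmulrn.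
by apply: le_trans h _; rewrite mulrnAC.
Qed.

Let phi x := sup (slopes x).

Let slopes_bounds x : has_sup (slopes x).
Proof.
split.
- have [n h] := archimedean (- x) u_ge0 u_neq0.
  exists ((- n%:Z)%:~R / 1%:R), (- n%:Z), 1%N; split => //.
  move: h; rewrite mulr1n mulrNz -pmulrn -le_subr opprK addrC => h.
  by rewrite -le_subr opprK.
- have [n h] := archimedean x u_ge0 u_neq0.
  exists (n%:Z%:~R / 1%:R) => _ [m [k [k0 -> mk]]].
  by apply: slope_le mk _.
Qed.

Let phi_ge x (m : int) (n : nat) : (0 < n)%N -> le (u *~ m) (x *+ n) ->
  m%:~R / n%:R <= phi x.
Proof.
by move=> n0 h; apply: ub_le_sup; [case: (slopes_bounds x)|exists m, n].
Qed.

Let phi_le x (m : int) (n : nat) : (0 < n)%N -> le (x *+ n) (u *~ m) ->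
  phi x <= m%:~R / n%:R.
Proof.
move=> n0 h; apply: ge_sup; first by case: (slopes_bounds x).
by move=> _ [k [p [p0 -> kp]]]; apply: slope_le kp h.
Qed.

Let ratr_frac (q : rat) : exists m : int, exists2 n : nat, (0 < n)%N &
  ratr q = m%:~R / n%:R :> R.
Proof.
exists (numq q), `|denq q|%N; first by rewrite absz_gt0 denq_neq0.
by rewrite /ratr pmulrn gez0_abs // denq_ge0.
Qed.

Let frac_between (a b : R) : a < b -> exists m : int, exists n : nat,
  [/\ (0 < n)%N, a < m%:~R / n%:R & m%:~R / n%:R < b].
Proof.
move=> /rat_in_itvoo[q]; have [m [n n0 ->]] := ratr_frac q.
by rewrite in_itv /= => /andP[aq qb]; exists m, n.
Qed.

Let phi_gt x (m : int) (n : nat) : (0 < n)%N ->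
  m%:~R / n%:R < phi x -> le (u *~ m) (x *+ n).
Proof.
move=> n0 h; have /orP[//|/phi_le -/(_ n0)] := le_total (u *~ m) (x *+ n).
by rewrite leNgt h.
Qed.

Let phi_lt x (m : int) (n : nat) : (0 < n)%N ->
  phi x < m%:~R / n%:R -> le (x *+ n) (u *~ m).
Proof.
move=> n0 h; have /orP[|//] := le_total (u *~ m) (x *+ n).
by move=> /phi_ge -/(_ n0); rewrite leNgt h.
Qed.

Let addf (m m' : int) (n n' : nat) : (0 < n)%N -> (0 < n')%N ->
  m%:~R / n%:R + m'%:~R / n'%:R =
  (m * n'%:Z + m' * n%:Z)%:~R / (n * n')%:R :> R.
Proof.
move=> n0 n'0; rewrite addf_div ?pnatr_eq0 -?lt0n// intrD !intrM natrM.
by rewrite -!pmulrn.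
Qed.

Let mulrnz (x : V) (m : int) (n : nat) : x *~ m *+ n = x *~ (m * n%:Z).
Proof. by rewrite mulrzA -pmulrn. Qed.

(** If the sides differed, fractions placed in the gap would bound [x] and [y] from the same side,
    and their sum, over a common denominator, would bound [x + y] on the wrong side of
    [phi (x + y)]. *)
Let phiD x y : phi (x + y) = phi x + phi y.
Proof.
apply/eqP; rewrite eq_le; apply/andP; split; rewrite leNgt; apply/negP => h.
- have [|m [n [n0 xq qq]]] := @frac_between (phi x) (phi (x + y) - phi y).
    by rewrite ltrBrDr.
  have [|m' [n' [n'0 yq qq']]] :=
    @frac_between (phi y) (phi (x + y) - m%:~R / n%:R); first by lra.
  have : phi (x + y) <= m%:~R / n%:R + m'%:~R / n'%:R; last by lra.
  rewrite addf//; apply: phi_le; first by rewrite muln_gt0 n0.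
  rewrite mulrnDl mulrzDr -!mulrnz; apply: leD.
    by rewrite mulrnA; apply: leMn; exact: phi_lt.
  by rewrite mulnC mulrnA; apply: leMn; exact: phi_lt.
- have [|m [n [n0 xq qq]]] := @frac_between (phi (x + y) - phi y) (phi x).
    by rewrite ltrBlDr.
  have [|m' [n' [n'0 yq qq']]] :=
    @frac_between (phi (x + y) - m%:~R / n%:R) (phi y); first by lra.
  have : m%:~R / n%:R + m'%:~R / n'%:R <= phi (x + y); last by lra.
  rewrite addf//; apply: phi_ge; first by rewrite muln_gt0 n0.
  rewrite mulrnDl mulrzDr -!mulrnz; apply: leD.
    by rewrite mulrnA; apply: leMn; exact: phi_gt.
  by rewrite mulnC mulrnA; apply: leMn; exact: phi_gt.
Qed.

Let phi0 : phi 0 = 0.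
Proof. by apply: (addrI (phi 0)); rewrite -phiD !addr0. Qed.

Let phiB x y : phi (x - y) = phi x - phi y.
Proof. by apply: (addIr (phi y)); rewrite -phiD !subrK. Qed.

Let phiMn x n : phi (x *+ n) = phi x *+ n.
Proof. by elim: n => [|n IHn]; rewrite ?mulr0n ?phi0// !mulrS phiD IHn. Qed.

Let phi_u : phi u = 1.
Proof.
apply/eqP; rewrite eq_le; apply/andP; split.
  by have := @phi_le u 1 1 isT; rewrite divr1; apply.
by have := @phi_ge u 1 1 isT; rewrite divr1; apply.
Qed.

Let phi_gt0 d : le 0 d -> d != 0 -> 0 < phi d.
Proof.
move=> d0 dn0; have [n un] := archimedean u d0 dn0.
have n0 : (0 < n)%N.
  rewrite lt0n; apply/eqP => n0; rewrite n0 mulr0n in un.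
  by move/eqP: u_neq0; apply; apply: le_anti; rewrite un.
by apply: lt_le_trans (@phi_ge d 1 n n0 un); rewrite divr_gt0// ltr0n.
Qed.

Let le_phi x y : le x y <-> phi x <= phi y.
Proof.
have imp a b : le a b -> phi a <= phi b.
  rewrite -le_subr -subr_ge0 -phiB => /(@phi_ge _ 0 1 isT).
  by rewrite divr1.
split; first exact: imp.
have /orP[//|yx] := le_total x y.
have [->|xy] := eqVneq x y; first by [].
rewrite -le_subr in yx; have := phi_gt0 yx; rewrite subr_eq0 xy phiB subr_gt0.
by move=> /(_ isT); rewrite ltNge => /negbTE ->.
Qed.

(** Halving [u] repeatedly gives coordinates [1 / 2 ^ j.+1], at most [1 / j.+1]. *)
Let phi_small (e : R) : 0 < e -> exists2 x, 0 < phi x & phi x < e.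
Proof.
move=> e0; have half j : exists x, x *+ (2 ^ j) = u.
  elim: j => [|j [x xj]]; first by exists u.
  by have [y yx] := halves x; exists y; rewrite expnS mulrnA mulr2n yx.
have [j je] := ltr_add_invr e0.
have [x xj] := half j.+1; exists x.
  have : 0 < phi x *+ (2 ^ j.+1) by rewrite -phiMn xj phi_u.
  by rewrite pmulrn_lgt0 // expn_gt0.
have h : phi x *+ 2 ^ j.+1 = 1 by rewrite -phiMn xj.
apply: le_lt_trans je; rewrite add0r -[leRHS]mul1r ler_pdivlMr ?ltr0n//.
have j2 : j.+1%:R <= (2 ^ j.+1)%:R :> R by rewrite ler_nat ltnW// ltn_expl.
rewrite -[leRHS]h -[leRHS]mulr_natr; apply: ler_wpM2l j2.
have : 0 <= phi x *+ (2 ^ j.+1) by rewrite h.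
by rewrite pmulrn_lge0 // expn_gt0.
Qed.

(** The preimage is the supremum of the elements of coordinate below [r]; if its coordinate were not
    [r], moving it by a small element would contradict its being the least upper bound. *)
Let phi_surj r : exists x, phi x = r.
Proof.
have phiu n : phi (u *+ n) = n%:R by rewrite phiMn phi_u.
have nat_gt (t : R) : exists n : nat, t < n%:R.
  exists (Num.bound `|t|); apply: le_lt_trans (ler_norm t) _.
  by rewrite archi_boundP.
have [||s sub slub] := @le_lub [set x | phi x < r].
- have [n rn] := nat_gt (- r); exists (0 - u *+ n) => /=.
  by rewrite phiB phi0 phiu sub0r ltrNl.
- have [n rn] := nat_gt r; exists (u *+ n) => x /= xr; apply/le_phi.
  by rewrite phiu ltW// (lt_trans xr).
exists s; apply/eqP; rewrite eq_le !leNgt.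
apply/andP; split; apply/negP => h.
- have [|x x0 xr] := @phi_small (phi s - r); first by rewrite subr_gt0.
  have /le_phi : le s (s - x); last by rewrite phiB; lra.
  by apply: slub => y /= yr; apply/le_phi; rewrite phiB; lra.
- have [|x x0 xr] := @phi_small (r - phi s); first by rewrite subr_gt0.
  have /le_phi : le (s + x) s; last by rewrite phiD; lra.
  by apply: sub; rewrite /= phiD; lra.
Qed.

(** The existence of halves rules out the integers: it provides the arbitrarily small elements on
    which surjectivity rests. *)
Lemma complete_ordered_group_real : exists f : V -> R,
  [/\ bijective f, forall x y, f (x + y) = f x + f y, f u = 1
    & forall x y, le x y <-> f x <= f y].
Proof.
have [g gK] := choice phi_surj.
exists phi; split => //; exists g => // x.
by apply: le_anti; apply/andP; split; apply/le_phi; rewrite gK.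
Qed.

End Hoelder.

(** * The group of translations *)

Section Continuum.

Context {d : Order.disp_t} (T : orderType d).
Hypothesis dense : forall x y : T, (x < y)%O -> exists z, (x < z < y)%O.
Hypothesis lub : lub_property (<=%O : rel T).

(** The fixed point is the supremum [s] of the points with [x <= F x]. If [F s] were different, a
    point strictly between [s] and [F s], together with its preimage under [F], would contradict the
    choice of [s]. *)
Lemma decreasing_fixpoint (F : T -> T) (x0 : T) :
  {mono F : x y /~ (x <= y)%O} -> (forall y, exists x, F x = y) ->
  exists x, F x = x.
Proof.
move=> decr surj; have decr_lt := leW_nmono decr.
have [||s sub slub] := @lub [set x | (x <= F x)%O].
- have [h|h] := leP x0 (F x0); first by exists x0.
  by exists (F x0); rewrite /= decr ltW.
- exists (Order.max x0 (F x0)) => x /= xF; rewrite leNgt gt_max.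
  apply/negP => /andP[x0x Fx0x].
  by have := lt_le_trans Fx0x xF; rewrite decr_lt ltNge ltW.
have above x : (s < x)%O -> (F x < x)%O.
  by rewrite !ltNge; apply: contra => /sub.
exists s; have [sF|Fs|//] := ltgtP s (F s).
- have [t /andP[st tF]] := dense sF; have [t' Ft'] := surj t; subst t.
  rewrite decr_lt in tF.
  by have := above _ st; rewrite decr_lt ltNge ltW// above.
- have [t /andP[Ft ts]] := dense Fs; have [t' Ft'] := surj t; subst t.
  rewrite decr_lt in Ft.
  have : (Order.max t' (F t') < s)%O by rewrite gt_max Ft.
  rewrite ltNge => /negP; case; apply: slub => x /= xF.
  rewrite leNgt gt_max; apply/negP => /andP[t'x Ft'x].
  by have := lt_le_trans Ft'x xF; rewrite decr_lt ltNge ltW.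
Qed.

Variable M : set (T -> T).
Hypothesis M_id : M id.
Hypothesis M_comp : forall f g, M f -> M g -> M (f \o g).
Hypothesis M_bij : forall f, M f -> bijective f.
Hypothesis M_mono : forall f, M f ->
  {mono f : x y / (x <= y)%O} \/ {mono f : x y /~ (x <= y)%O}.
Hypothesis M_incr : forall P Q : T,
  exists f, [/\ M f, {mono f : x y / (x <= y)%O} & f P = Q].
Hypothesis M_decr : forall P Q : T,
  exists f, [/\ M f, {mono f : x y /~ (x <= y)%O} & f P = Q].
Hypothesis M_incr_uniq : forall f g P, M f -> M g ->
  {mono f : x y / (x <= y)%O} -> {mono g : x y / (x <= y)%O} ->
  f P = g P -> f = g.

Lemma motion_group_real (R : realType) (O E : T) : (O < E)%O ->
  exists phi : T -> R,
    [/\ bijective phi, phi O = 0 /\ phi E = 1,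
        {mono phi : x y / (x <= y)%O} &
        forall g, M g <-> exists p : R,
          (forall x, phi (g x) = p + phi x) \/
          (forall x, phi (g x) = p - phi x)].
Proof.
move=> OE.
have [t tP] := choice (fun P => M_incr O P).
have tM P : M (t P) by case: (tP P).
have t_mono P : {mono t P : x y / (x <= y)%O} by case: (tP P).
have tO P : t P O = P by case: (tP P).
have incrE f : M f -> {mono f : x y / (x <= y)%O} -> f = t (f O).
  by move=> fM fi; apply: (M_incr_uniq (P := O)); rewrite ?tO.
(* Both sides are increasing motions sending [O] to [t P Q], hence equal; this is associativity. The
   identities for [s] below use the same uniqueness. *)
have tD P Q : t (t P Q) = t P \o t Q.
  rewrite (incrE (t P \o t Q)) /= ?tO//; first exact: M_comp.
  by move=> x y; rewrite /= !t_mono.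
have t0 : t O = id by rewrite [RHS](incrE id).
have [s [sM s_decr sO]] := M_decr O O.
have sK : involutive s.
  move=> x; have -> : s (s x) = (s \o s) x by [].
  rewrite (incrE (s \o s)) /= ?sO ?t0//; first exact: M_comp.
  by move=> a b; rewrite /= !s_decr.
have s_add P Q : s (t P Q) = t (s P) (s Q).
  have -> : t (s P) = s \o t P \o s.
    rewrite (incrE (s \o t P \o s)) /= ?sO ?tO//.
      by apply: M_comp => //; exact: M_comp.
    by move=> a b; rewrite /= s_decr t_mono s_decr.
  by rewrite /= sK.
(* The reflection [t P \o s] has a fixed point [Q] by continuity, so that its
   square, an increasing motion fixing [Q], is the identity. *)
have ts P : exists2 Q, t P (s Q) = Q & forall x, t P (s (t P (s x))) = x.
  pose F := t P \o s.
  have FM : M F by exact: M_comp.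
  have F_decr : {mono F : x y /~ (x <= y)%O}.
    by move=> a b; rewrite /= t_mono s_decr.
  have [|Q FQ] := decreasing_fixpoint O F_decr.
    by move=> y; have [G _ GK] := M_bij FM; exists (G y).
  exists Q => // x; rewrite -[RHS]/(id x) -[LHS]/((F \o F) x).
  congr (_ x); apply: (M_incr_uniq (P := Q)) => //.
  - exact: M_comp.
  - by move=> a b; rewrite /= !F_decr.
  - by rewrite /= !FQ.
(* The involution [t P \o s] is evaluated at [O]: [s] is the inversion. *)
have trs P : t P (s P) = O.
  by have [_ _ /(_ O)] := ts P; rewrite sO tO.
have tA : associative t by move=> P Q U; rewrite tD.
have tr0 P : t P O = P := tO P.
have tl0 : left_id O t by move=> P; rewrite t0.
have tls : left_inverse O s t by move=> P; rewrite -{2}(sK P) trs.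
(* An inversion that is also an automorphism forces commutativity. *)
have tC : commutative t.
  have inv P Q : t P Q = O -> P = s Q.
    by move=> PQ; rewrite -(tr0 P) -(trs Q) tA PQ tl0.
  move=> P Q; rewrite (inv (t Q P) (s (t P Q))) ?sK// s_add.
  by rewrite tA -(tA Q) trs tr0 trs.
pose V : zmodType := HB.pack T (GRing.isZmodule.Build T tA tC tl0 tls).
have [|||||||||f [f_bij fD fE f_mono]] :=
  @complete_ordered_group_real R V (<=%O : rel T) E.
- exact: le_refl.
- exact: le_anti.
- exact: le_trans.
- exact: le_total.
- by move=> P Q U; rewrite /= t_mono.
- exact: lub.
(* The fixed point of [t P \o s] satisfies [Q = P - Q], so it is half of [P]. *)
- move=> P; have [Q QE _] := ts P; exists Q.
  change (t Q Q = P); by rewrite -{1}QE -tA tls tr0.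
- exact: ltW.
- by apply/eqP => EO; rewrite EO ltxx in OE.
have {}fD x y : f (t x y) = f x + f y := fD x y.
have {}f_mono x y : (f x <= f y) = (x <= y)%O.
  by apply/idP/idP => /f_mono.
have f0 : f O = 0 by apply: (addrI (f O)); rewrite -fD tr0 addr0.
have fs x : f (s x) = - f x by apply/eqP; rewrite -addr_eq0 -fD tls f0.
have f_inj := bij_inj f_bij.
exists f; split=> // g; split=> [gM|[p]].
  have [g_incr|g_decr] := M_mono gM.
    by exists (f (g O)); left => x; rewrite {1}(incrE g)// fD.
  exists (f (g O)); right => x; rewrite -fs -fD.
  (* Composing the decreasing [g] with [s] gives an increasing motion with the same value at [O]. *)
  have -> : t (g O) = g \o s.
    rewrite (incrE (g \o s)) /= ?sO//; first exact: M_comp.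
    by move=> a b; rewrite /= g_decr s_decr.
  by rewrite /= sK.
have [f' _ f'K] := f_bij; move=> [|] gp.
  rewrite (_ : g = t (f' p)) //; apply/funext => x; apply: f_inj.
  by rewrite gp fD f'K.
rewrite (_ : g = t (f' p) \o s); first exact: M_comp.
by apply/funext => x; apply: f_inj; rewrite gp /= fD f'K fs.
Qed.

End Continuum.

(** * Coordinates on Erlangen lines *)

(** The direction of [f] on the ends of an interval is inherited by every pair inside ([up], [dn]);
    since any two pairs lie in a common interval, the direction is the same everywhere. *)
Lemma between_monotone d d' (T : orderType d) (T' : orderType d')
    (f : T -> T') : injective f ->
  (forall x y z, (x <= y <= z)%O ->
     (f x <= f y <= f z)%O || (f z <= f y <= f x)%O) ->
  {mono f : x y / (x <= y)%O} \/ {mono f : x y /~ (x <= y)%O}.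
Proof.
move=> f_inj f_betw.
have up z x y w : (z <= x)%O -> (x <= y)%O -> (y <= w)%O ->
    (f z <= f w)%O -> (f x <= f y)%O.
  move=> zx xy yw fzw; have zy := le_trans zx xy.
  have /f_betw/orP[/andP[zfy _]|/andP[wfy yfz]] : (z <= y <= w)%O by apply/andP.
    have /f_betw/orP[/andP[]//|/andP[h1 h2]] : (z <= x <= y)%O by apply/andP.
    exact: le_trans h2 zfy.
  have yz : y = z by apply: f_inj; apply/le_anti; rewrite yfz (le_trans fzw).
  by suff -> : x = y by []; apply/le_anti; rewrite xy yz zx.
have dn z x y w : (z <= x)%O -> (x <= y)%O -> (y <= w)%O ->
    (f w <= f z)%O -> (f y <= f x)%O.
  move=> zx xy yw fwz; have xw := le_trans xy yw.
  have /f_betw/orP[/andP[zfx xfw]|/andP[wfx xfz]] : (z <= x <= w)%O by apply/andP.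
    have xw' : x = w by apply: f_inj; apply/le_anti; rewrite xfw (le_trans fwz).
    suff -> : x = y by [].
    by apply/le_anti; rewrite xy xw' yw.
  have /f_betw/orP[/andP[h1 h2]|/andP[]//] : (x <= y <= w)%O by apply/andP.
  exact: le_trans h2 wfx.
have [[a [b [ab fab]]]|h] := pselect (exists a b, (a < b)%O /\ (f a < f b)%O).
  left; apply: le_mono => x y xy; rewrite lt_neqAle (inj_eq f_inj) lt_eqF//=.
  (* This interval contains both pairs; if [f] reversed its ends, [dn] would make it reverse [a] and
     [b]. *)
  apply: (up (Order.min a x) _ _ (Order.max b y)) => //.
  - by rewrite ge_min lexx orbT.
  - exact: ltW.
  - by rewrite le_max lexx orbT.
  - rewrite leNgt; apply/negP => /ltW fwz.
    suff : (f b <= f a)%O by rewrite leNgt fab.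
    apply: dn fwz; [by rewrite ge_min lexx|exact: ltW|].
    by rewrite le_max lexx.
right; apply: le_nmono => x y yx; rewrite ltNge; apply/negP => fyx.
apply: h; exists y, x; split=> //.
by rewrite lt_neqAle fyx (inj_eq f_inj) lt_eqF.
Qed.

Lemma motion_seg (L : erlangenLine) (f : L -> L) (A B C : L) :
  motion f -> seg A B C -> seg (f A) (f B) (f C).
Proof.
have [iso _ _ _] := motion_subgroup L.
by move=> /iso[_ fseg] ABC; rewrite -fseg; exists C.
Qed.

(** Through the order, the axiom on rays says that exactly one increasing motion, and some
    decreasing one, sends a given point to another; this is what [motion_group_real] requires. *)
Lemma erlangen_coordinate (R : realType) (L : erlangenLine) (A0 A1 : L) :
  A0 <> A1 -> exists phi : L -> R,
    [/\ bijective phi, phi A0 = 0 /\ phi A1 = 1,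
        forall A B C, seg A B C <->
          (phi A <= phi C <= phi B) || (phi B <= phi C <= phi A) &
        forall g, motion g <-> exists p : R,
          (forall x, phi (g x) = p + phi x) \/
          (forall x, phi (g x) = p - phi x)].
Proof.
move=> A01; have [le [[leRR leanti letrans letot] [le01 segP ends dense lub]]] :=
  line_order (line_connected L) A01.
pose C : choiceType :=
  HB.pack (Defs.point L) (gen_eqMixin L) (gen_choiceMixin L).
pose P : porderType (Order.Disp tt tt) := HB.pack C
  (Order.Le_isPOrder.Build (Order.Disp tt tt) C leRR leanti letrans).
pose T : orderType (Order.Disp tt tt) :=
  HB.pack P (Order.POrder_isTotal.Build (Order.Disp tt tt) P letot).
have {}le01 : ((A0 : T) < (A1 : T))%O 
  by rewrite lt_neqAle; apply/andP; split; [exact/eqP|exact: le01].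
have {}dense (x y : T) : (x < y)%O -> exists z, (x < z < y)%O.
  rewrite lt_neqAle => /andP[/eqP xy /(dense _ _ xy)[z [zx zy xz zy']]].
  exists z; rewrite !lt_neqAle; apply/andP.
  by split; apply/andP; split => //; apply/eqP => // /esym.
have {}ends (x : T) : (exists y, (y < x)%O) /\ exists y, (x < y)%O.
  have [[y yx lyx] [z zx lxz]] := ends x.
  split; [exists y|exists z]; rewrite lt_neqAle; apply/andP; split => //.
    exact/eqP.
  by apply/eqP => /esym.
have {}segP (a b c : T) :
    seg (a : L) b c <-> (a <= c <= b)%O || (b <= c <= a)%O by exact: segP.
have mono (f : T -> T) : @motion L f ->
    {mono f : x y / (x <= y)%O} \/ {mono f : x y /~ (x <= y)%O}.
  move=> fM; have [iso _ _ _] := motion_subgroup L.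
  apply: between_monotone; first by have [/bij_inj] := iso _ fM.
  move=> x y z xyz; apply/segP; apply: motion_seg => //; apply/segP.
  by rewrite xyz.
(* The two maximal rays from [x] as half-lines. Increasing motions send [up x] to [up (f x)],
   decreasing ones to [dn (f x)]. *)
pose up (x : T) : set L := [set y : T | (x <= y)%O].
pose dn (x : T) : set L := [set y : T | (y <= x)%O].
have ray (x : T) : maximal_ray (up x) /\ maximal_ray (dn x).
  pose gt_x : set L := [set y : T | (x < y)%O].
  pose lt_x : set L := [set y : T | (y < x)%O].
  have gt_cvx : convex gt_x.
    move=> y z yx zx t /segP/orP[|] /andP[h _]; [exact: lt_le_trans yx h|].
    exact: lt_le_trans zx h.
  have lt_cvx : convex lt_x.
    move=> y z yx zx t /segP/orP[|] /andP[_ h]; [exact: le_lt_trans h zx|].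
    exact: le_lt_trans h yx.
  have [[y yx] [z xz]] := ends x.
  have cover : ~` [set (x : L)] = gt_x `|` lt_x.
    apply/seteqP; split=> [t /= tx|t [|] /= + tx]; last 2 first.
    - by rewrite /gt_x /= tx ltxx.
    - by rewrite /lt_x /= tx ltxx.
    have [xt|xt|/esym//] := ltgtP (x : T) t; [by left|by right].
  have disj : gt_x `&` lt_x = set0.
    by apply/seteqP; split=> // t [/= h1 h2]; have := lt_trans h1 h2; rewrite ltxx.
  have between_x b c : gt_x b -> lt_x c -> seg b c x.
    by move=> /ltW xb /ltW cx; apply/segP; rewrite cx xb orbT.
  split; exists x.
  - exists gt_x, lt_x; split; last first.
      apply/seteqP; split => t /=; last by move=> [->|/ltW//]; exact: lexx.
      by rewrite /up /= le_eqVlt => /orP[/eqP|]; [left|right].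
    by split=> //; split=> //; [exists z|exists y].
  - exists lt_x, gt_x; split; last first.
      apply/seteqP; split => t /=; last by move=> [->|/ltW//]; exact: lexx.
      by rewrite /dn /= le_eqVlt => /orP[/eqP|]; [left|right].
    split=> //.
    + by rewrite setUC setIC.
    + by split; [exists y|exists z].
    + by move=> b c bx cx; apply: seg_sym; exact: between_x.
have surj (f : T -> T) : @motion L f -> forall y, exists x, f x = y.
  have [iso _ _ _] := motion_subgroup L.
  by move=> /iso[[g _ gK] _] y; exists (g y).
have up_image (f : T -> T) (x : T) : @motion L f ->
    {mono f : x y / (x <= y)%O} -> f @` up x = up (f x).
  move=> fM f_mono; apply/seteqP; split=> [_ [y xy <-]|y].
    by rewrite /up /= f_mono.
  by have [z <-] := surj _ fM y; rewrite /up /= f_mono => xz; exists z.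
have dn_image (f : T -> T) (x : T) : @motion L f ->
    {mono f : x y /~ (x <= y)%O} -> f @` up x = dn (f x).
  move=> fM f_anti; apply/seteqP; split=> [_ [y xy <-]|y].
    by rewrite /dn /= f_anti.
  by have [z <-] := surj _ fM y; rewrite /dn /= f_anti => xz; exists z.
have up_inj (x y : T) : up x = up y -> x = y.
  move=> xy; apply/le_anti/andP; split.
    by have : up y y by [exact: lexx]; rewrite -xy.
  by have : up x x by [exact: lexx]; rewrite xy.
have dn_inj (x y : T) : dn x = dn y -> x = y.
  move=> xy; apply/le_anti/andP; split.
    by have : dn x x by [exact: lexx]; rewrite xy.
  by have : dn y y by [exact: lexx]; rewrite -xy.
(* As there is no largest point, an upper half-line is never a lower one; the kind of the target ray
   therefore decides whether a motion increases. *)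
have up_dn (x y : T) : up x <> dn y.
  move=> xy; have [_ [z]] := ends (Order.max x y).
  rewrite gt_max => /andP[/ltW xz yz].
  by have : up x z by []; rewrite xy /dn /= leNgt yz.
have [_ motion_id motion_comp _] := motion_subgroup L.
have motion_bij (f : T -> T) : @motion L f -> bijective f.
  by have [iso _ _ _] := motion_subgroup L => /iso[].
have motion_incr (x y : T) :
    exists f : T -> T, [/\ @motion L f, {mono f : x y / (x <= y)%O} & f x = y].
  have [f [[fM f_up] _]] := motion_rays (ray x).1 (ray y).1.
  have [f_mono|f_anti] := mono _ fM.
    by exists f; split=> //; apply: up_inj; rewrite -up_image.
  by case: (@up_dn y (f x)); rewrite -dn_image.
have motion_decr (x y : T) :
    exists f : T -> T, [/\ @motion L f, {mono f : x y /~ (x <= y)%O} & f x = y].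
  have [f [[fM f_dn] _]] := motion_rays (ray x).1 (ray y).2.
  have [f_mono|f_anti] := mono _ fM.
    by case: (@up_dn (f x) y); rewrite -up_image.
  by exists f; split=> //; apply: dn_inj; rewrite -dn_image.
have motion_incr_uniq (f g : T -> T) (x : T) : @motion L f -> @motion L g ->
    {mono f : x y / (x <= y)%O} -> {mono g : x y / (x <= y)%O} ->
    f x = g x -> f = g.
  move=> fM gM f_mono g_mono fgx.
  have [h [_ h_uniq]] := motion_rays (ray x).1 (ray (f x)).1.
  rewrite -(h_uniq f); last by split=> //; exact: up_image.
  by rewrite -(h_uniq g)//; split=> //; rewrite fgx; exact: up_image.
have [phi [phi_bij phi01 phi_mono phiM]] :=
  motion_group_real dense lub motion_id motion_comp motion_bij
    mono motion_incr motion_decr motion_incr_uniq R le01.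
exists phi; split=> // a b c; rewrite !phi_mono; exact: segP.
Qed.

(** * Distances and their preservation in coordinates *)

Section EqDist.

Variables (R : realType) (L : erlangenLine) (phi : L -> R).
Hypothesis phi_bij : bijective phi.
Hypothesis phi_seg : forall A B C, seg A B C <->
  (phi A <= phi C <= phi B) || (phi B <= phi C <= phi A).
Hypothesis phi_motion : forall g, motion g <-> exists p : R,
  (forall x, phi (g x) = p + phi x) \/ (forall x, phi (g x) = p - phi x).

(** Motions preserve coordinate differences up to sign, and a segment determines its length;
    conversely a translation or a reflection matches segments of equal length. *)
Lemma eq_distE A B C D :
  eq_dist A B C D <-> `|phi A - phi B| = `|phi C - phi D|.
Proof.
have [psi phiK psiK] := phi_bij.
have iso tau : motion tau -> tau @` seg A B = seg (tau A) (tau B).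
  by have [h _ _ _] := motion_subgroup L => /h[].
split=> [[tau tauM]|].
  rewrite iso// => segE.
  have -> : `|phi A - phi B| = `|phi (tau A) - phi (tau B)|.
    have /phi_motion[p [] h] := tauM; rewrite !h; first by congr `|_|; ring.
    by rewrite -normrN; congr `|_|; ring.
  (* Each end point of one description of the segment lies in the other description; these
     inequalities force equal lengths. *)
  have : seg (tau A) (tau B) C by rewrite segE; exact: seg_l.
  have : seg (tau A) (tau B) D by rewrite segE; exact: seg_r.
  have : seg C D (tau A) by rewrite -segE; exact: seg_l.
  have : seg C D (tau B) by rewrite -segE; exact: seg_r.
  move=> /phi_seg/orP h1 /phi_seg/orP h2 /phi_seg/orP h3 /phi_seg/orP h4.
  case: ger0P => ?; case: ger0P => ?;
    case: h1 => /andP[? ?]; case: h2 => /andP[? ?];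
    case: h3 => /andP[? ?]; case: h4 => /andP[? ?]; lra.
pose shift p x := psi (p + phi x); pose flip p x := psi (p - phi x).
have shiftM p : motion (shift p).
  by apply/phi_motion; exists p; left => x; rewrite /shift psiK.
have flipM p : motion (flip p).
  by apply/phi_motion; exists p; right => x; rewrite /flip psiK.
(* Both the translation by [phi C - phi A] and the reflection with constant [phi C + phi A] send [A]
   to [C]; the sign decides which sends [B] to [D]. *)
move=> /eqP; rewrite eqr_norm2 => /orP[] /eqP s.
- exists (shift (phi C - phi A)) => //; rewrite iso// /shift subrK phiK.
  by rewrite (_ : _ + phi B = phi D) ?phiK//; lra.
- exists (flip (phi C + phi A)) => //; rewrite iso// /flip addrK phiK.
  by rewrite (_ : _ - phi B = phi D) ?phiK//; lra.
Qed.

End EqDist.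

(** Such a map is increasing, since it is monotone and fixes 0 and 1. Preserving equality of
    distances makes it additive, so it fixes the natural numbers, and monotonicity leaves no room
    elsewhere. *)
Lemma isometry_fixing_0_1 (R : realType) (h : R -> R) :
  injective h -> h 0 = 0 -> h 1 = 1 ->
  (forall x y z, x <= y <= z ->
     (h x <= h y <= h z) || (h z <= h y <= h x)) ->
  (forall x y z t, `|x - y| = `|z - t| -> `|h x - h y| = `|h z - h t|) ->
  h = id.
Proof.
move=> h_inj h0 h1 h_betw h_dist.
have [h_mono|h_anti] := between_monotone h_inj h_betw; last first.
  by have := h_anti 0 1; rewrite h0 h1 ler01 ler10.
(* The pair [y], [x] is compared with the pair [y - x], [0]. *)
have h_shift x y : x <= y -> h y - h x = h (y - x).
  move=> xy; have := @h_dist y x (y - x) 0; rewrite subr0 => /(_ erefl).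
  by rewrite h0 subr0 !ger0_norm ?subr_ge0 ?h_mono// -h0 h_mono subr_ge0.
have hD x y : 0 <= y -> h (x + y) = h x + h y.
  move=> y0; have := @h_shift x (x + y); rewrite lerDl => /(_ y0).
  by rewrite (addrAC x) subrr add0r => <-; rewrite [RHS]addrC subrK.
have hMn x n : 0 <= x -> h (x * n%:R) = h x * n%:R.
  move=> x0; elim: n => [|n IHn]; first by rewrite !mulr0.
  by rewrite -natr1 !mulrDr !mulr1 hD// IHn.
have h_id x : 0 <= x -> h x = x.
  move=> x0; apply/eqP; rewrite -subr_eq0 -normr_le0 leNgt; apply/negP.
  move=> /ltr_add_invr[k]; rewrite add0r; apply/negP; rewrite -leNgt.
  have hn n : h n%:R = n%:R by rewrite -[n%:R]mul1r hMn// h1.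
  have xk0 : 0 <= x * k.+1%:R by rewrite mulr_ge0.
  (* Both [x * k.+1] and its image lie between [m] and [m.+1], so [h x] and [x] differ by at most
     [1 / k.+1], against the choice of [k]. *)
  set m := Num.truncn (x * k.+1%:R).
  have /andP[mx xm] := truncn_itv xk0.
  have := h_mono m%:R (x * k.+1%:R); rewrite mx hn hMn// => hm.
  have := h_mono (x * k.+1%:R) m.+1%:R; rewrite (ltW xm) hn hMn// => hm'.
  rewrite -[leRHS]mul1r ler_pdivlMr// -[X in _ * X]ger0_norm// -normrM mulrBl.
  rewrite ler_norml; rewrite -(natr1 m) in xm hm'.
  by apply/andP; split; lra.
apply/funext => x; have [x0|/ltW x0] := leP 0 x; first exact: h_id.
have := hD x (- x); rewrite oppr_ge0 subrr h0 => /(_ x0).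
by rewrite (h_id (- x)) ?oppr_ge0// => /esym/eqP; rewrite subr_eq0 => /eqP.
Qed.

Theorem theorem10p6 (L1 L2 : erlangenLine) :
  (forall (A0 A1 : L1) (B0 B1 : L2), A0 <> A1 -> B0 <> B1 ->
     exists! f : L1 -> L2,
       [/\ bijective f,
           preserves_betweenness f,
           f A0 = B0,
           f A1 = B1
         & forall A B C D : L1,
             eq_dist A B C D -> eq_dist (f A) (f B) (f C) (f D)]) /\
  erlangen_isomorphic L1 L2.
Proof.
have coordinate := @erlangen_coordinate (Rdefinitions.R : realType).
split.
  move=> A0 A1 B0 B1 /coordinate[phi [phi_bij [phi0 phi1] phi_seg phi_motion]].
  move=> /coordinate[psi [psi_bij [psi0 psi1] psi_seg psi_motion]].
  have [phi' phiK phi'K] := phi_bij; have [psi' psiK psi'K] := psi_bij.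
  (* The map matches points with equal coordinates, [A0], [A1] and [B0], [B1] having coordinates 0
     and 1. *)
  exists (psi' \o phi); split; first split.
  - by exists (phi' \o psi) => x /=; rewrite ?psi'K ?phi'K ?phiK ?psiK.
  - by move=> A B C /phi_seg ABC; apply/psi_seg; rewrite /= !psi'K.
  - by rewrite /= phi0 -psi0 psiK.
  - by rewrite /= phi1 -psi1 psiK.
  - move=> A B C D /(eq_distE phi_bij phi_seg phi_motion) dist.
    by apply/(eq_distE psi_bij psi_seg psi_motion); rewrite /= !psi'K.
  move=> g [g_bij g_betw g0 g1 g_dist].
  (* A competitor [g], read in coordinates, is a self-map of the reals fixing 0 and 1. *)
  suff h_id : psi \o g \o phi' = id.
    apply/funext => x /=; apply: (can_inj psiK); rewrite psi'K.
    by have /= := congr1 (@^~ (phi x)) h_id; rewrite phiK.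
  apply: isometry_fixing_0_1 => /=.
  - apply: inj_comp (can_inj phi'K); apply: inj_comp (bij_inj g_bij).
    exact: can_inj psiK.
  - by rewrite -[X in phi' X]phi0 phiK g0.
  - by rewrite -[X in phi' X]phi1 phiK g1.
  - move=> x y z xyz; apply/psi_seg/g_betw/phi_seg.
    by rewrite !phi'K xyz.
  - move=> x y z t xyzt; apply/(eq_distE psi_bij psi_seg psi_motion)/g_dist.
    by apply/(eq_distE phi_bij phi_seg phi_motion); rewrite !phi'K.
(* Any two distinct points serve as base points. In coordinates the motions of both lines are the
   same maps, so matching coordinates conjugates one group onto the other. *)
have [[A0 [A1 /coordinate[phi [phi_bij _ phi_seg phi_motion]]]] _ _] :=
  line_connected L1.
have [[B0 [B1 /coordinate[psi [psi_bij _ psi_seg psi_motion]]]] _ _] :=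
  line_connected L2.
have [phi' phiK phi'K] := phi_bij; have [psi' psiK psi'K] := psi_bij.
exists (psi' \o phi); split.
  by move=> A B C /phi_seg ABC; apply/psi_seg; rewrite /= !psi'K.
exists (phi' \o psi); split=> [x|x|g _] /=; rewrite ?psi'K ?phi'K ?phiK ?psiK//.
split=> [/psi_motion|/phi_motion] [p gp]; [apply/phi_motion|apply/psi_motion].
  by exists p; case: gp => gp; [left|right] => x; rewrite /= phi'K gp psi'K.
exists p; case: gp => gp; [left|right] => x;
  by have /= := gp (phi' (psi x)); rewrite !phi'K psiK.
Qed.
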